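(* Let $U$, $(U_j)_{j\ge1}$ be i.i.d. uniform $[0,1]$ random variables and $(E_j)_{j\ge1}$ i.i.d. standard exponential random variables, all independent. For $k\ge1$ let $$B_k=\Big(\frac{E_1}{U}+\frac{E_2}{U\,U_1}+\dots+\frac{E_k}{U\,U_1\cdots U_{k-1}}\Big)\big(1-U\,U_1\cdots U_k\big).$$ Then for every integer $k\ge1$ and every $s>0$, $$P(B_k>s)=-I_2(s)\int_0^s \xi\,e^{\xi}\,q_{k-1}(\xi)\,d\xi+\sum_{j=0}^{k-1}q_j(s).$$
   Context: $\sigma_1(k,j)$ are the unsigned Stirling numbers of the first kind ($\sigma_1(k,j)=0$ for $k<j$, $\sigma_1(0,0)=1$); $p_j(t)=e^{-t}\sum_{k=j}^\infty \frac{t^k}{k!}\frac{\sigma_1(k,j)}{k!}$; $q_j(t)=\frac1t\int_0^t p_j(u)\,du$ (so $q_0(t)=(1-e^{-t})/t$); $I_2(s)=\int_s^\infty\frac{e^{-\xi}}{\xi^2}\,d\xi$. *)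

(* Defs.v *)
From HB Require Import structures.
From mathcomp Require Import all_boot all_order all_algebra.
From mathcomp Require Import all_classical all_reals all_analysis.
Set Implicit Arguments. Unset Strict Implicit. Unset Printing Implicit Defensive.
Import Order.TTheory GRing.Theory Num.Theory.
Import numFieldNormedType.Exports.
Local Open Scope classical_set_scope.
Local Open Scope ring_scope.

Fixpoint stirling1 (n k : nat) : nat :=
  match n, k with
  | 0, 0 => 1
  | 0, _.+1 => 0
  | _.+1, 0 => 0
  | n'.+1, k'.+1 => n' * stirling1 n' k'.+1 + stirling1 n' k'
  end%N.

Definition pj {R : realType} (j : nat) (t : R) : R :=
  expR (- t) * \big[+%R/0%R]_(j <= k <oo) (t ^+ k / (k`!)%:R * ((stirling1 k j)%:R / (k`!)%:R)).

Definition qj {R : realType} (j : nat) (t : R) : R :=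
  t^-1 * (\int[lebesgue_measure]_(u in `[0, t]) pj j u).

Definition I2 {R : realType} (s : R) : R :=
  \int[lebesgue_measure]_(x in `[s, +oo[) (expR (- x) / x ^+ 2).

Definition mutually_independent d (T : measurableType d) (R : realType)
    (P : probability T R) (I : eqType) (X : I -> T -> R) : Prop :=
  forall (J : seq I) (A : I -> set R),
    uniq J -> (forall i, measurable (A i)) ->
    P (\bigcap_(i in [set` J]) (X i @^-1` A i)) =
      \big[*%E/1%E]_(i <- J) P (X i @^-1` A i).

(* the joint family (U = V 0, U_j = V j ; E_j = E (j-1)) *)
Definition joint_family (T : Type) (R : Type) (V E : nat -> T -> R)
    : (nat + nat)%type -> T -> R :=
  fun i => match i with inl j => V j | inr j => E j end.

(* B_k with U = V 0, U_i = V i, E_i = E (i-1) *)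
Definition Bk {T : Type} {R : realType} (V E : nat -> T -> R) (k : nat) (w : T) : R :=
  (\sum_(i < k) E i w / \prod_(m < i.+1) V m w) * (1 - \prod_(m < k.+1) V m w).

(* Main.v *)
Require Import Defs.
From HB Require Import structures.
From mathcomp Require Import all_boot all_order all_algebra.
From mathcomp Require Import all_classical all_reals all_analysis.
From mathcomp Require Import measurable_realfun ring lra.
Import Order.TTheory GRing.Theory Num.Theory.
Import numFieldNormedType.Exports.
Local Open Scope classical_set_scope.
Local Open Scope ring_scope.

(* The products W_k = U U_1 ... U_k are the successive record minima of uniform
   samples arriving at unit rate: at level x the next record comes after an
   exponential time of rate x, at a uniform point of [0, x].  If S_k is the sum
   in B_k, i.e. the time of the k-th record, then B_k = S_k (1 - W_k).
   Alternating the two moves shows by induction that (S_k, W_k) has density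
   e^{-ty} (1-y) q_{k-1}(t(1-y)) on t > 0, 0 < y < 1.  Integrate it over
   t(1-y) <= s, first in y: this gives e^{-t} N(min(t, s)) / t^2, where
   N(x) = int_0^x xi e^xi q_{k-1}(xi) dxi.  The times t >= s contribute
   N(s) I2(s), and the times t < s contribute 1 - sum_{j<k} q_j(s), because
   e^{-t} N(t) / t^2 = - sum_{j<k} q_j'(t).  The identities between the p_j and
   the q_j all follow from the recurrence of the Stirling numbers, which reads
   (t e^t q_j)' = t e^t q_j + e^t p_j and (e^t p_{j+1})' = e^t q_j. *)

(** * The power series of the Stirling numbers *)

Lemma stirling1_le_fact n j : (stirling1 n j <= n`!)%N.
Proof.
elim: n j => [|n IH] [|j] //=.
by rewrite factS mulSn addnC leq_add// leq_mul.
Qed.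

Lemma stirling1_small n j : (n < j)%N -> stirling1 n j = 0%N.
Proof.
elim: n j => [|n IH] [|j] //=; rewrite ltnS => nj.
by rewrite !IH// ?muln0// (leq_trans nj).
Qed.

Section factorial_bounded.
Context {R : realType}.
Implicit Types (c : R^nat) (x : R).

(** The upper bound gives convergence on the whole line by comparison with the exponential series,
    and the class is stable under formal differentiation. Nonnegativity carries over to the sums on
    the half-line x >= 0. *)
Definition fact_bounded c := forall n, 0 <= c n <= (n`!%:R)^-1.

Lemma fact_bounded_diffs c : fact_bounded c -> fact_bounded (pseries_diffs c).
Proof.
move=> fc n; have /andP[c0 c1] := fc n.+1; rewrite /pseries_diffs mulr_ge0//=.
apply: (le_trans (ler_wpM2l _ c1)) => //.
by rewrite factS natrM invfM mulVKf// pnatr_eq0.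
Qed.

Lemma is_cvg_fact_bounded c x : fact_bounded c -> cvgn (pseries c x).
Proof.
move=> fc; apply: normed_cvg; apply: (@series_le_cvg _ _ (exp_coeff `|x|)) => /=.
- by move=> n; rewrite normr_ge0.
- by move=> n; rewrite /exp_coeff/= mulr_ge0// exprn_ge0.
- move=> n; have /andP[c0 c1] := fc n.
  by rewrite /exp_coeff/= normrM normrX (ger0_norm c0) mulrC ler_wpM2l ?exprn_ge0.
- exact: is_cvg_series_exp_coeff.
Qed.

Definition psum c x : R := limn (pseries c x).

Lemma is_derive_psum c x : fact_bounded c ->
  is_derive x 1 (psum c) (psum (pseries_diffs c) x).
Proof.
(* Any point of modulus larger than that of x would serve as the radius, since all three series
   converge everywhere. *)
move=> fc; apply: (@pseries_snd_diffs _ _ (`|x| + 1)).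
- exact: is_cvg_fact_bounded.
- exact/is_cvg_fact_bounded/fact_bounded_diffs.
- exact/is_cvg_fact_bounded/fact_bounded_diffs/fact_bounded_diffs.
- by rewrite [ltRHS]ger0_norm ?addr_ge0// ltrDl.
Qed.

Lemma psum_ge0 c x : fact_bounded c -> 0 <= x -> 0 <= psum c x.
Proof.
move=> fc x0; apply: limr_ge; first exact: is_cvg_fact_bounded.
near=> n; apply: sumr_ge0 => i _.
by have /andP[c0 _] := fc i; rewrite mulr_ge0// exprn_ge0.
Unshelve. all: by end_near. Qed.

Lemma psum_const c x : (forall n, c n.+1 * x ^+ n.+1 = 0) -> psum c x = c 0%N.
Proof.
move=> c0; apply: lim_near_cst => //; near=> n.
rewrite /pseries/= /series/= -(prednK (_ : 0 < n)%N); last by near: n;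
    exact: nbhs_infty_gt.
by rewrite big_nat_recl//= big1 ?addr0 ?expr0 ?mulr1// => i _; rewrite c0.
Unshelve. all: by end_near. Qed.

(** The operator x d/dx multiplies the n-th coefficient by n and leaves the powers unshifted, so
    differential equations can be compared coefficient by coefficient. *)
Lemma cvg_mul_psum_diffs c x : fact_bounded c ->
  series (fun n => n%:R * c n * x ^+ n) @ \oo --> x * psum (pseries_diffs c) x.
Proof.
move=> fc.
have /pseries_diffs_equiv h : cvgn (pseries (pseries_diffs c) x).
  exact/is_cvg_fact_bounded/fact_bounded_diffs.
rewrite (_ : series _ =
    (fun n => x * series (fun i => i%:R * c i * x ^+ i.-1) n)).
  by apply: cvgM; [exact: cvg_cst|exact: h].
(* At i = 0 the truncated exponent [i.-1] is harmless because the factor i is 0. *)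
apply/funext => n; rewrite /series /= mulr_sumr; apply: eq_bigr => -[|i] _ /=.
  by rewrite !mul0r mulr0.
by rewrite exprS; ring.
Qed.

Definition stirling_coef j : R^nat :=
  fun n => (stirling1 n j)%:R / n`!%:R / n`!%:R.

Lemma fact_bounded_stirling_coef j : fact_bounded (stirling_coef j).
Proof.
move=> n; rewrite /stirling_coef !divr_ge0//= ler_pdivrMr ?ltr0n ?fact_gt0//.
by rewrite mulVf ?pnatr_eq0 -?lt0n ?fact_gt0// ler_pdivrMr ?ltr0n ?fact_gt0//
    mul1r ler_nat stirling1_le_fact.
Qed.

(* [exp_p j x] is e^x p_j(x) and [exp_q j x] is e^x q_j(x). *)
Definition exp_p j : R -> R := psum (stirling_coef j).
Definition exp_q j : R -> R := psum (pseries_diffs (stirling_coef j.+1)).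
Definition dexp_q j : R -> R := psum (pseries_diffs (pseries_diffs
    (stirling_coef j.+1))).

#[local] Hint Resolve fact_bounded_stirling_coef fact_bounded_diffs : core.

Lemma exp_p0 x : exp_p 0 x = 1.
Proof.
by rewrite /exp_p psum_const /stirling_coef//= ?invr1 ?mulr1// => n; rewrite !mul0r.
Qed.

Lemma exp_p_at0 j : exp_p j 0 = (j == 0)%:R.
Proof.
rewrite /exp_p psum_const /stirling_coef//= ?invr1 ?mulr1; first by case: j.
by move=> n; rewrite expr0n mulr0.
Qed.

Lemma exp_q_at0 j : exp_q j 0 = (j == 0)%:R.
Proof.
rewrite /exp_q psum_const /pseries_diffs /stirling_coef//=; last first.
  by move=> n; rewrite expr0n mulr0.
by rewrite !invr1 !mulr1 mul1r add0n; case: j.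
Qed.

(** The relation (e^x p_{j+1})' = e^x q_j is built into the definition of [exp_q]; agreement with
    the integral formula for [qj] is only established in [qjE]. *)
Lemma is_derive_exp_pS j x : is_derive x 1 (exp_p j.+1) (exp_q j x).
Proof. exact: is_derive_psum. Qed.

Lemma is_derive_exp_q j x : is_derive x 1 (exp_q j) (dexp_q j x).
Proof. by apply: is_derive_psum; exact: fact_bounded_diffs. Qed.

Lemma exp_q_ge0 j x : 0 <= x -> 0 <= exp_q j x.
Proof. by apply: psum_ge0; exact: fact_bounded_diffs. Qed.

Lemma exp_p_ge0 j x : 0 <= x -> 0 <= exp_p j x.
Proof. by apply: psum_ge0. Qed.

(* Coefficientwise this is the recurrence of the Stirling numbers. *)
Lemma exp_q_ode j x : exp_q j x + x * dexp_q j x = x * exp_q j x + exp_p j x.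
Proof.
have c1 : series (fun n => pseries_diffs (stirling_coef j.+1) n * x ^+ n) @ \oo
    --> exp_q j x.
  by apply: is_cvg_fact_bounded; exact: fact_bounded_diffs.
have c2 := cvg_mul_psum_diffs _ x (fact_bounded_diffs _
    (fact_bounded_stirling_coef j.+1)).
have c3 := cvg_mul_psum_diffs _ x (fact_bounded_stirling_coef j.+1).
have c4 : series (fun n => stirling_coef j n * x ^+ n) @ \oo --> exp_p j x.
  exact: is_cvg_fact_bounded.
have c12 := cvgD (FF := eventually_filter) c1 c2.
have c34 := cvgD (FF := eventually_filter) c3 c4.
suff E : series (fun n => pseries_diffs (stirling_coef j.+1) n * x ^+ n) +
    series (fun n => n%:R * pseries_diffs (stirling_coef j.+1) n * x ^+ n) =
    series (fun n => n%:R * stirling_coef j.+1 n * x ^+ n) +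
    series (fun n => stirling_coef j n * x ^+ n).
  by rewrite E in c12; rewrite -(cvg_lim _ c12)// -(cvg_lim _ c34).
apply/funext => n; rewrite !fctE /series/= -!big_split/=; apply: eq_bigr => i _.
(* On the left the coefficient carries (i+1)^2, which cancels against (i+1)!^2; what remains is the
   Stirling recurrence divided by i!^2. *)
rewrite /pseries_diffs /stirling_coef /= factS !natrM natrD natrM.
have i0 : i.+1%:R != 0 :> R by rewrite pnatr_eq0.
have f0 : i`!%:R != 0 :> R by rewrite pnatr_eq0 -lt0n fact_gt0.
have iE : i.+1%:R = i%:R + 1 :> R by rewrite -natr1.
by rewrite !iE in i0 *; field; rewrite i0 f0.
Qed.

(** The sum in [pj] starts at j and the power series at 0; the extra terms vanish by
    [stirling1_small]. *)
Lemma pjE j x : pj j x = expR (- x) * exp_p j x.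
Proof.
rewrite /pj /exp_p /psum; congr (_ * _).
suff -> : (fun n => \sum_(j <= k < n)
    (x ^+ k / (k`!)%:R * ((stirling1 k j)%:R / (k`!)%:R))) =
    pseries (stirling_coef j) x by [].
apply/funext => n; rewrite /pseries /series /=.
under [RHS]eq_bigr do rewrite /stirling_coef.
have [nj|jn] := leqP n j.
  rewrite big_geq// big_nat big1// => i /andP[_ ij].
  by rewrite stirling1_small ?(leq_trans ij)// !mul0r.
rewrite [RHS](big_cat_nat (leq0n j) (ltnW jn))/= [X in X + _]big_nat.
rewrite [X in X + _]big1 ?add0r; last first.
  by move=> i /andP[_ ij]; rewrite stirling1_small// !mul0r.
by apply: eq_bigr => i _; ring.
Qed.

End factorial_bounded.

(** * Calculus of the functions p and q *)

Section calculus.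
Context {R : realType}.
Implicit Types (f g F : R -> R) (x y a b : R).

(** In this applied form the differentiation rules compose as terms, and [ring] or [field] can match
    the resulting derivative. *)
Lemma is_derive_mul {f g x df dg} : is_derive x 1 f df -> is_derive x 1 g dg ->
  is_derive x 1 (fun y => f y * g y) (df * g x + f x * dg).
Proof.
move=> hf hg; have h := is_deriveM hf hg.
rewrite (_ : (fun y => f y * g y) = f * g)//; apply: (is_derive_eq h).
by rewrite /GRing.scale/= addrC mulrC.
Qed.

Lemma is_derive_add {f g x df dg} : is_derive x 1 f df -> is_derive x 1 g dg ->
  is_derive x 1 (fun y => f y + g y) (df + dg).
Proof. by move=> hf hg; exact: is_deriveD. Qed.

Lemma is_derive_comp_mul {f g x df dg} :
  is_derive (g x) 1 f df -> is_derive x 1 g dg ->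
  is_derive x 1 (fun y => f (g y)) (df * dg).
Proof. by move=> hf hg; exact: is_derive1_comp. Qed.

Lemma is_derive_expRN x : is_derive x 1 (fun y => expR (- y)) (- expR (- x)).
Proof.
apply: (is_derive_eq (is_derive_comp_mul (is_derive_expR _) (is_deriveNid x 1))).
by rewrite mulrN1.
Qed.

Lemma is_derive_continuous f df : (forall x, is_derive x 1 f (df x)) ->
  continuous f.
Proof.
move=> h x; apply: differentiable_continuous; apply/derivable1_diffP.
by have [] := h x.
Qed.

Lemma FTC_closed {f F a b} : a <= b -> continuous f ->
  (forall x, is_derive x 1 F (f x)) ->
  (\int[lebesgue_measure]_(x in `[a, b]) (f x)%:E = (F b - F a)%:E)%E.
Proof.
rewrite le_eqVlt => /orP[/eqP <-|ab] cf dF.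
  by rewrite set_itv1 integral_set1 subrr.
have cF := is_derive_continuous _ _ dF.
rewrite (@continuous_FTC2 _ f F)// ?EFinB//.
- exact: continuous_subspaceT.
- split.
  + by move=> x _; have [] := dF x.
  + by apply: cvg_at_right_filter; exact: cF.
  + by apply: cvg_at_left_filter; exact: cF.
- by move=> x _; rewrite derive1E; apply: derive_val.
Qed.

End calculus.

(** * Differential relations between the p_j, the q_j and their primitives *)

Section record_functions.
Context {R : realType}.
Implicit Types (x y t : R).

(* p_j and q_j as entire functions; at 0 the formula for [qj] gives the junk
   value 0. *)
Definition p_ext j x : R := expR (- x) * exp_p j x.
Definition q_ext j x : R := expR (- x) * exp_q j x.
(* 1 if j = 0, and the integral of q_{j-1} from 0 to x otherwise. *)
Definition q_prim j x : R := x * q_ext j x + p_ext j x.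

Lemma continuous_exp_p j : continuous (@exp_p R j).
Proof.
apply: is_derive_continuous => x; apply: is_derive_psum.
exact: fact_bounded_stirling_coef.
Qed.

Lemma continuous_exp_q j : continuous (@exp_q R j).
Proof. exact: is_derive_continuous (is_derive_exp_q j). Qed.

Lemma continuous_dexp_q j : continuous (@dexp_q R j).
Proof.
apply: is_derive_continuous => x; apply: is_derive_psum.
do 2 apply: fact_bounded_diffs; exact: fact_bounded_stirling_coef.
Qed.

Lemma continuous_expRN : continuous (fun x : R => expR (- x)).
Proof. exact: is_derive_continuous is_derive_expRN. Qed.

Definition dq_ext j x : R := expR (- x) * (dexp_q j x - exp_q j x).

Lemma is_derive_q_ext j x : is_derive x 1 (q_ext j) (dq_ext j x).
Proof.
apply: (is_derive_eq (is_derive_mul (is_derive_expRN x) (is_derive_exp_q j x))).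
by rewrite /dq_ext; ring.
Qed.

Lemma continuous_q_ext j : continuous (@q_ext j).
Proof. exact: is_derive_continuous (is_derive_q_ext j). Qed.

Lemma continuous_dq_ext j : continuous (@dq_ext j).
Proof.
move=> x; apply: cvgM; first exact: continuous_expRN.
by apply: cvgB; [exact: continuous_dexp_q|exact: continuous_exp_q].
Qed.

Lemma continuous_p_ext j : continuous (@p_ext j).
Proof.
by move=> x; apply: cvgM; [exact: continuous_expRN|exact: continuous_exp_p].
Qed.

(** This is (x q_j)' = p_j: differentiating e^{-x} absorbs the term x e^x q_j of [exp_q_ode]. *)
Lemma q_ext_ode j x : q_ext j x + x * dq_ext j x = p_ext j x.
Proof.
rewrite /q_ext /dq_ext /p_ext; have := exp_q_ode j x => h.
have -> : exp_p j x = exp_q j x + x * dexp_q j x - x * exp_q j x by rewrite h; ring.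
ring.
Qed.

Lemma is_derive_mul_q_ext j x : is_derive x 1 (fun y => y * q_ext j y) (p_ext j x).
Proof.
apply: (is_derive_eq (is_derive_mul (is_derive_id x 1) (is_derive_q_ext j x))).
by rewrite -q_ext_ode mul1r.
Qed.

(** Both x q_j(x) and the integral of p_j from 0 to x vanish at 0 and have derivative p_j. *)
Lemma qjE j x : 0 < x -> qj j x = q_ext j x.
Proof.
move=> x0; rewrite /qj /Rintegral.
under eq_integral do rewrite pjE -/(p_ext j _).
rewrite (FTC_closed (ltW x0) (continuous_p_ext j) (is_derive_mul_q_ext j)).
by rewrite /= mul0r subr0 mulKf// gt_eqF.
Qed.

Lemma q_ext_ge0 j x : 0 <= x -> 0 <= q_ext j x.
Proof. by move=> x0; rewrite mulr_ge0 ?expR_ge0// exp_q_ge0. Qed.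

Lemma q_prim_ge0 j x : 0 <= x -> 0 <= q_prim j x.
Proof.
move=> x0; apply: addr_ge0; first by rewrite mulr_ge0// q_ext_ge0.
by rewrite mulr_ge0 ?expR_ge0// exp_p_ge0.
Qed.

(** The derivative is p_0(x) - e^{-x} = 0, so the value is the one at 0. *)
Lemma q_prim0 x : q_prim 0 x = 1.
Proof.
have dL y : is_derive y 1 (q_prim 0) 0.
  have -> : q_prim 0 = fun z => z * q_ext 0 z + expR (- z).
    by apply/funext => z; rewrite /q_prim /p_ext exp_p0 mulr1.
  apply: (is_derive_eq (is_derive_add (is_derive_mul_q_ext 0 y) (is_derive_expRN y))).
  by rewrite /p_ext exp_p0 mulr1 subrr.
have -> : q_prim 0 x = q_prim 0 0.
  by apply: is_derive_0_is_cst => y; exact: dL.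
by rewrite /q_prim mul0r add0r /p_ext oppr0 expR0 exp_p_at0 mul1r.
Qed.

Lemma q_primS_at0 j : q_prim j.+1 (0 : R) = 0.
Proof. by rewrite /q_prim mul0r add0r /p_ext exp_p_at0 mulr0. Qed.

(** The first term has derivative p_{j+1}, the second -p_{j+1} + q_j. *)
Lemma is_derive_q_primS j x : is_derive x 1 (q_prim j.+1) (q_ext j x).
Proof.
apply: (is_derive_eq (is_derive_add (is_derive_mul_q_ext j.+1 x)
  (is_derive_mul (is_derive_expRN x) (is_derive_exp_pS j x)))).
by rewrite /p_ext /q_ext; ring.
Qed.

Lemma continuous_q_prim j : continuous (@q_prim j).
Proof.
move=> x; apply: cvgD; last exact: continuous_p_ext.
by apply: cvgM => //; exact: continuous_q_ext.
Qed.

(* The antiderivative of [x * exp_q k.-1 x] vanishing at 0. *)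
Definition weighted_q_prim k x : R := x * \sum_(j < k) (exp_q j x - exp_p j x).

(** For j >= 1 the j-th summand, multiplied by x, has derivative x e^x (q_j - q_{j-1}), and for j =
    0 it has derivative x e^x q_0; the sum telescopes. *)
Lemma is_derive_weighted_q_primS k x : is_derive x 1 (weighted_q_prim k.+1) (x *
    exp_q k x).
Proof.
have dPi j : is_derive x 1 (fun y => y * exp_q j y) (x * exp_q j x + exp_p j x).
  apply: (is_derive_eq (is_derive_mul (is_derive_id x 1) (is_derive_exp_q j x))).
  by rewrite mul1r exp_q_ode.
elim: k => [|k IH].
  rewrite (_ : weighted_q_prim 1 = fun y => y * exp_q 0 y - y).
    apply: (is_derive_eq (is_derive_add (dPi 0) (is_deriveNid x 1))).
    by rewrite exp_p0; ring.
  by apply/funext => y; rewrite /weighted_q_prim big_ord1 exp_p0; ring.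
rewrite (_ : weighted_q_prim k.+2 = fun y => weighted_q_prim k.+1 y + (y * exp_q
    k.+1 y + - (y * exp_p k.+1 y))).
  apply: (is_derive_eq (is_derive_add IH (is_derive_add (dPi k.+1) (is_deriveN
    (is_derive_mul (is_derive_id x 1) (is_derive_exp_pS k x)))))).
  by ring.
by apply/funext => y; rewrite /weighted_q_prim [in LHS]big_ord_recr/=; ring.
Qed.

Lemma weighted_q_prim_at0 k : weighted_q_prim k (0 : R) = 0.
Proof. by rewrite /weighted_q_prim mul0r. Qed.

Lemma continuous_mul_exp_q k : continuous (fun x : R => x * exp_q k x).
Proof.
by move=> x; apply: cvgM => //; exact: continuous_exp_q.
Qed.

Lemma integral_mul_exp_q k x : 0 <= x ->
  (\int[lebesgue_measure]_(r in `[0%R, x]) (r * exp_q k r)%:E =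
      (weighted_q_prim k.+1 x)%:E)%E.
Proof.
move=> x0; rewrite (FTC_closed x0 (continuous_mul_exp_q k)
    (is_derive_weighted_q_primS k)).
by rewrite weighted_q_prim_at0 subr0.
Qed.

Lemma weighted_q_prim_ge0 k x : 0 <= x -> 0 <= weighted_q_prim k.+1 x.
Proof.
move=> x0; rewrite -lee_fin -integral_mul_exp_q//; apply: integral_ge0 => y /=.
by rewrite in_itv/= => /andP[y0 _]; rewrite lee_fin mulr_ge0// exp_q_ge0.
Qed.

(** By [q_ext_ode] each (q_j - p_j) / x equals -q_j', which makes the density over early times an
    exact derivative. *)
Lemma weighted_q_prim_dq_ext k x : x != 0 ->
  expR (- x) * (weighted_q_prim k x / x ^+ 2) = - \sum_(j < k) dq_ext j x.
Proof.
move=> x0; rewrite -sumrN /weighted_q_prim.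
transitivity (\sum_(j < k) (expR (- x) / x) * (exp_q j x - exp_p j x)).
  by rewrite -mulr_sumr; field.
apply: eq_bigr => j _.
have /eqP := q_ext_ode j x; rewrite -subr_eq0 => /eqP.
rewrite /q_ext /p_ext => h.
have -> : dq_ext j x = (expR (- x) * exp_p j x - expR (- x) * exp_q j x) / x.
  by apply: (mulfI x0); rewrite [RHS]mulrCA mulfV// mulr1; lra.
by field.
Qed.

Lemma integral_weighted_q_prim k s : 0 <= s ->
  (\int[lebesgue_measure]_(t in `]0%R, s[) (expR (- t) * (weighted_q_prim k.+1 t
      / t ^+ 2))%:E =
   (1 - \sum_(j < k.+1) q_ext j s)%:E)%E.
Proof.
move=> s0.
pose F x : R := - \sum_(j < k.+1) q_ext j x.
pose f x : R := - \sum_(j < k.+1) dq_ext j x.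
have dF x : is_derive x 1 F (f x).
  have -> : F = - \sum_(j < k.+1) (q_ext j : R -> R).
    by apply/funext => y; rewrite /F !fctE fct_sumE.
  exact: (is_deriveN (is_derive_sum (fun j : 'I_k.+1 => is_derive_q_ext j x))).
have cf : continuous f.
  move=> x; apply: cvgN; apply: cvg_big => [|j _]; last exact: continuous_dq_ext.
  exact: add_continuous.
(* Only q_0 is nonzero at 0, where it equals 1. *)
have -> : 1 - \sum_(j < k.+1) q_ext j s = F s - F 0.
  rewrite /F opprK addrC; congr (_ + _); rewrite big_ord_recl/= big1 => [|j _].
    by rewrite addr0 /q_ext oppr0 expR0 exp_q_at0 mulr1.
  by rewrite /q_ext exp_q_at0 mulr0.
(* The two integrands are matched on the open interval only, because the quotient by t^2 is not the
   derivative at 0. *)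
rewrite -(FTC_closed s0 cf dF) [RHS]integral_itv_bndoo; last first.
  apply/measurable_EFinP/measurable_funTS; exact: continuous_measurable_fun.
apply: eq_integral => x; rewrite inE/= in_itv/= => /andP[x0 _].
by rewrite weighted_q_prim_dq_ext// gt_eqF.
Qed.

End record_functions.

(** * Densities and independence *)

Section density_integral.
Local Open Scope ereal_scope.
Context {R : realType} {d : measure_display} {T : measurableType d}.
Variables (m nu : {measure set T -> \bar R}) (g : T -> R).
Hypotheses (mg : measurable_fun setT g) (g0 : forall x, (0 <= g x)%R).
Hypothesis mE : forall C, measurable C -> m C = \int[nu]_(x in C) (g x)%:E.

Import HBNNSimple.

(** On indicators this is [mE]; linearity gives simple functions, and monotone convergence on both
    sides gives the rest. *)
Lemma ge0_integral_density (f : T -> \bar R) :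
  measurable_fun setT f -> (forall x, 0 <= f x) ->
  \int[m]_x f x = \int[nu]_x (f x * (g x)%:E).
Proof.
move=> mf f0; pose f_ := nnsfun_approx measurableT mf.
transitivity (limn (fun n => \int[m]_x (f_ n x)%:E)).
  rewrite -monotone_convergence//.
  - apply: eq_integral => y _; apply/esym/cvg_lim => //.
    exact: cvg_nnsfun_approx.
  - by move=> n; exact/measurable_EFinP/measurable_funP.
  - by move=> n y _; rewrite lee_fin.
  - by move=> y _ i j ij; rewrite lee_fin; exact/lefP/nd_nnsfun_approx.
transitivity (limn (fun n => \int[nu]_x ((f_ n x)%:E * (g x)%:E))); last first.
  rewrite -monotone_convergence//.
  - apply: eq_integral => y _; apply/cvg_lim => //.
    by apply: cvgeZr => //; exact: cvg_nnsfun_approx.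
  - by move=> n; apply/measurable_EFinP/measurable_funM => //.
  - by move=> n y _; rewrite -EFinM lee_fin mulr_ge0.
  - move=> y _ i j ij; rewrite -!EFinM lee_fin ler_wpM2r//.
    exact/lefP/nd_nnsfun_approx.
congr (limn _); apply/funext => n.
have mg' : measurable_fun setT (fun x => (g x)%:E) by exact/measurable_EFinP.
under eq_integral do rewrite fimfunE -fsumEFin//.
rewrite ge0_integral_fsum//; last 2 first.
- by move=> r; exact/measurable_EFinP/measurable_funM.
- by move=> r x _; rewrite nnfun_muleindic_ge0.
transitivity (\sum_(r \in range (f_ n))
    \int[nu]_x ((r * \1_(f_ n @^-1` [set r]) x)%:E * (g x)%:E)); last first.
  rewrite -ge0_integral_fsum//.
  - apply: eq_integral => x _; rewrite -ge0_mule_fsuml; last first.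
      by move=> r; rewrite nnfun_muleindic_ge0.
    by rewrite fsumEFin// -fimfunE.
  - move=> r; apply: emeasurable_funM => //.
    by apply/measurable_EFinP/measurable_funM.
  - move=> r x _; rewrite mule_ge0//; first by rewrite EFinM nnfun_muleindic_ge0.
    by rewrite lee_fin.
apply: eq_fsbigr => r rr.
have r0 : (0 <= r)%R by move: rr; rewrite inE => -[x _ <-].
rewrite integralZl_indic_nnsfun// integral_indic// setIT mE//.
under [RHS]eq_integral do rewrite EFinM -muleA.
rewrite ge0_integralZl//; last 2 first.
- by apply: emeasurable_funM => //; exact/measurable_EFinP.
- by move=> x _; rewrite mule_ge0// lee_fin.
congr (_ * _); rewrite integral_mkcond; apply: eq_integral => x _.
by rewrite patchE indicE; case: ifPn => _; rewrite ?mul1e ?mul0e.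
Qed.

End density_integral.

(* The library's canonical sigma-finite structure on [m1 \x m2] is shadowed by
   the one for subprobabilities; iterated products need this repackaging. *)
Definition sigma_finite_prod {R : realType} {d1 d2} {T1 : measurableType d1}
    {T2 : measurableType d2} (m1 : {sigma_finite_measure set T1 -> \bar R})
    (m2 : {sigma_finite_measure set T2 -> \bar R}) :
    {sigma_finite_measure set (T1 * T2)%type -> \bar R} :=
  HB.pack (m1 \x m2)%E (Measure_isSigmaFinite.Build _ _ _ (m1 \x m2)%E
    (lebesgue_integral_fubini.product_measure_sigma_finite_subproof m1 m2)).

Section density.
Local Open Scope ereal_scope.
Context {R : realType} {d : measure_display} {T : measurableType d}.
Variable P : probability T R.

(** The density is an honest real function, nonnegative at every point, so that Tonelli applies
    without handling null sets. *)
Definition has_density {d1} {T1 : measurableType d1}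
    (nu : set T1 -> \bar R) (Y : T -> T1) (g : T1 -> R) :=
  [/\ measurable_fun setT Y, measurable_fun setT g, forall x, (0 <= g x)%R
    & forall C, measurable C -> P (Y @^-1` C) = \int[nu]_(x in C) (g x)%:E].

Definition family_event {I : eqType} (X : I -> T -> R) (J : seq I)
    (A : I -> set R) : set T :=
  \bigcap_(i in [set` J]) (X i @^-1` A i).

(** Independence is tested on finite cylinder events only. The predicate D records which variables
    the construction has not consumed yet, and shrinks along the induction. *)
Definition indep_of {I : eqType} (X : I -> T -> R) (D : pred I) {d1}
    {T1 : measurableType d1} (Y : T -> T1) :=
  forall J A C, uniq J -> all D J -> (forall i, measurable (A i)) ->
    measurable C ->
    P (Y @^-1` C `&` family_event X J A) = P (Y @^-1` C) * P (family_event X J A).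

Lemma indep_of_comp {I : eqType} (X : I -> T -> R) (D : pred I) {d1 d2}
    {T1 : measurableType d1} {T2 : measurableType d2} (Y : T -> T1)
    (f : T1 -> T2) :
  measurable_fun setT f -> indep_of X D Y -> indep_of X D (f \o Y).
Proof.
move=> mf iY J A C uJ DJ mA mC; rewrite comp_preimage; apply: iY => //.
by rewrite -[X in measurable X]setTI; exact: mf.
Qed.

Section pair.
Context {I : eqType} (X : I -> T -> R).
Hypothesis mX : forall i, measurable_fun setT (X i).
Hypothesis hind : mutually_independent P X.

Lemma measurable_preimage {d1} {T1 : measurableType d1} (Y : T -> T1) C :
  measurable_fun setT Y -> measurable C -> measurable (Y @^-1` C).
Proof. by move=> mY mC; rewrite -[X in measurable X]setTI; exact: mY. Qed.

Lemma measurable_family_event J A : (forall i, measurable (A i)) ->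
  measurable (family_event X J A).
Proof.
move=> mA; apply: fin_bigcap_measurable => // i _.
exact: measurable_preimage.
Qed.

Lemma family_event_cons i J A C : i \notin J ->
  family_event X (i :: J) (fun j => if j == i then C else A j) =
  X i @^-1` C `&` family_event X J A.
Proof.
move=> iJ; have ji j : j \in J -> (j == i) = false.
  by move=> jJ; apply/eqP => ji; rewrite -ji jJ in iJ.
apply/seteqP; split => [w Fw|w [Cw Fw] j].
  split => [|j jJ]; first by have := Fw i; rewrite /= mem_head eqxx; exact.
  by have := Fw j; rewrite /= inE jJ orbT ji//; exact.
rewrite /= inE; case: eqVneq => [->//|_ /=]; exact: Fw.
Qed.

(** Prepending i to J makes the intersection a single family event, whose product formula splits off
    its first factor. *)
Lemma indep_of_family i (D : pred I) : ~~ D i -> indep_of X D (X i).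
Proof.
move=> Di J A C uJ DJ mA mC.
have iJ : i \notin J by apply/negP => /(allP DJ); rewrite (negbTE Di).
rewrite -family_event_cons// /family_event !hind//=; last 2 first.
- by rewrite iJ.
- by move=> j; case: ifP.
rewrite big_cons eqxx; congr (_ * _); apply: eq_big_seq => j jJ.
by case: eqVneq => // ji; rewrite -ji jJ in iJ.
Qed.

(** For fixed F both sides are finite measures in C that agree on rectangles, hence everywhere. F is
    a family event when independence is propagated and the whole space when only the law of the pair
    is wanted. *)
Lemma product_law {d1 d2} {T1 : measurableType d1} {T2 : measurableType d2}
    (Y : {mfun T >-> T1}) (Z : {mfun T >-> T2}) (F : set T) :
  measurable F ->
  (forall A B, measurable A -> measurable B ->
    P (Y @^-1` A `&` (Z @^-1` B `&` F)) = P (Y @^-1` A) * (P (Z @^-1` B) * P F)) ->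
  forall C, measurable C ->
    P ((fun w => (Y w, Z w)) @^-1` C `&` F) =
    (distribution P Y \x distribution P Z) C * P F.
Proof.
move=> mF YZ C mC.
have mYZ : measurable_fun setT (fun w => (Y w, Z w)).
  exact: measurable_fun_pair.
pose m' : {measure set (T1 * T2) -> \bar R} :=
  measure_function_pushforward__canonical__measure_function_Measure (mrestr P mF) mYZ.
have c0 : (0 <= fine (P F))%R by exact: fine_ge0.
(* The constant P F is absorbed into the second factor, so that the right-hand side is itself a
   product measure. *)
pose m2 : {finite_measure set T2 -> \bar R} :=
  mscale (NngNum c0) (distribution P Z).
have PF : (fine (P F))%:E = P F by rewrite fineK// fin_num_measure.
transitivity ((distribution P Y \x m2) C).
  rewrite (@product_measure_unique _ _ _ _ _ (distribution P Y) m2 m')//.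
  move=> A B mA mB; rewrite /m2 /= /mscale/= PF [P F * _]muleC.
  by rewrite -YZ// setIA.
rewrite /product_measure1 muleC -PF -ge0_integralZl//=.
exact: measurable_fun_xsection.
Qed.

(** On rectangles, first Y splits off from the family event containing i, then X i from the
    remaining indices; [product_law] passes to general C. *)
Lemma indep_of_pair {d1} {T1 : measurableType d1} (Y : T -> T1) (i : I)
    (D D' : pred I) :
  measurable_fun setT Y -> indep_of X D Y -> D i ->
  (forall j, D' j -> D j && (j != i)) ->
  indep_of X D' (fun w => (Y w, X i w)).
Proof.
move=> mY iY Di DD' J A C uJ DJ mA mC.
pose Ym : {mfun T >-> T1} := HB.pack Y (isMeasurableFun.Build _ _ _ _ _ mY).
pose Zm : {mfun T >-> R} := HB.pack (X i) (isMeasurableFun.Build _ _ _ _ _ (mX i)).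
have iJ : i \notin J by apply/negP => /(allP DJ)/DD'; rewrite eqxx andbF.
have DJ' : all D J by apply/allP => j /(allP DJ)/DD'/andP[].
have iX := indep_of_family i (predC1 i).
have law F : measurable F -> (forall A B, measurable A -> measurable B ->
    P (Y @^-1` A `&` (X i @^-1` B `&` F)) = P (Y @^-1` A) * (P (X i @^-1` B) * P F)) ->
    P ((fun w => (Y w, X i w)) @^-1` C `&` F) =
    (distribution P Ym \x distribution P Zm) C * P F.
  by move=> mF h; apply: (product_law Ym Zm) => //.
have rect J' : uniq J' -> all D J' -> i \notin J' ->
    forall A' B, measurable A' -> measurable B ->
    P (Y @^-1` A' `&` (X i @^-1` B `&` family_event X J' A)) =
    P (Y @^-1` A') * (P (X i @^-1` B) * P (family_event X J' A)).
  move=> uJ' DJ0 iJ' A' B mA' mB.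
  rewrite -family_event_cons// iY//=; last 3 first.
  - by rewrite iJ'.
  - by rewrite Di.
  - by move=> j; case: ifP.
  rewrite family_event_cons// iX//=; first by rewrite eqxx.
  by apply/allP => j jJ; apply/eqP => ji; rewrite -ji jJ in iJ'.
rewrite law; last 2 first.
- exact: measurable_family_event.
- by apply: rect.
congr (_ * _); rewrite -[_ @^-1` C]setIT.
(* Seen as the event of the empty list, the whole space lets the same law compute the unconditioned
   probability of the pair. *)
have -> : [set: T] = family_event X [::] A by apply/seteqP; split.
rewrite law; last 2 first.
- exact: measurable_family_event.
- exact: rect.
rewrite [family_event _ _ _](_ : _ = setT); last by apply/seteqP; split.
by rewrite probability_setT mule1.
Qed.

Lemma indep_of_law {d1} {T1 : measurableType d1} (Y : {mfun T >-> T1}) (i : I)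
    (Z : {mfun T >-> R}) (D : pred I) (C : set (T1 * R)) :
  indep_of X D Y -> D i -> X i = Z -> measurable C ->
  P ((fun w => (Y w, Z w)) @^-1` C) = (distribution P Y \x distribution P Z) C.
Proof.
move=> iY Di XZ mC; rewrite -[_ @^-1` C]setIT product_law//.
  by rewrite probability_setT mule1.
move=> A B mA mB; rewrite setIT probability_setT mule1.
have := iY [:: i] (fun=> B) A isT; rewrite /= Di => /(_ isT (fun=> mB) mA).
have -> // : family_event X [:: i] (fun=> B) = Z @^-1` B.
rewrite -XZ; apply/seteqP; split => w; first by move=> /(_ i); apply;
    rewrite /= mem_head.
by move=> Bw j; rewrite /= inE => /eqP ->.
Qed.

(** Given Y = x, the variable phi (x, X i) has density kappa (x, .), and Fubini over the law of Y
    multiplies the two densities. The kernel is constrained only where g is nonzero, which is where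
    the levels to be divided by are positive. *)
Lemma has_density_extend {d1} {T1 : measurableType d1}
    (nu : {sigma_finite_measure set T1 -> \bar R}) (Y : T -> T1) (g : T1 -> R)
    (i : I) (D : pred I) (phi : T1 * R -> R) (kappa : T1 * R -> R) :
  has_density nu Y g -> indep_of X D Y -> D i ->
  measurable_fun setT phi -> measurable_fun setT kappa ->
  (forall p, (0 <= kappa p)%R) ->
  (forall x, g x != 0%R -> forall C, measurable C ->
    P [set w | C (phi (x, X i w))] =
    \int[lebesgue_measure]_(a in C) (kappa (x, a))%:E) ->
  has_density (nu \x lebesgue_measure) (fun w => (Y w, phi (Y w, X i w)))
    (fun p => g p.1 * kappa p)%R.
Proof.
move=> [mY mg g0 Yg] iY Di mphi mkappa kappa0 phikappa.
have mgk : measurable_fun setT (fun p : T1 * R => g p.1 * kappa p)%R.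
  by apply: measurable_funM => //; exact: measurableT_comp.
split => //.
- apply: measurable_fun_pair => //; apply: (measurableT_comp mphi).
  exact: measurable_fun_pair.
- by move=> p; rewrite mulr_ge0.
move=> C mC.
pose Ym : {mfun T >-> T1} := HB.pack Y (isMeasurableFun.Build _ _ _ _ _ mY).
pose Zm : {mfun T >-> R} := HB.pack (X i) (isMeasurableFun.Build _ _ _ _ _ (mX i)).
(* The event on (Y, phi (Y, X i)) becomes an event on the independent pair (Y, X i). *)
pose C' := (fun p : T1 * R => (p.1, phi p)) @^-1` C.
have mC' : measurable C'.
  rewrite -[X in measurable X]setTI; apply: measurable_fun_pair => //.
have -> : P ((fun w => (Y w, phi (Y w, X i w))) @^-1` C) =
    \int[distribution P Ym]_x distribution P Zm (xsection C' x).
  by rewrite -[RHS]/((distribution P Ym \x distribution P Zm) C')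
    -(@indep_of_law _ _ Ym i Zm D).
rewrite (@ge0_integral_density _ _ _ _ nu g)//=; last first.
  exact: measurable_fun_xsection.
rewrite [RHS]integral_mkcond [RHS]fubini_tonelli1//=; last 2 first.
- apply/measurable_restrict => //.
  exact/measurable_funTS/measurable_EFinP.
- by move=> p; rewrite patchE; case: ifP => // _; rewrite lee_fin mulr_ge0.
apply: eq_integral => x _; rewrite /fubini_F.
have [gx0|gx0] := eqVneq (g x) 0%R.
  rewrite gx0 mule0 integral0_eq// => a _.
  by rewrite patchE; case: ifP => // _; rewrite gx0 mul0r.
have mk x' : measurable_fun setT (fun a => (kappa (x', a))%:E).
  by apply/measurable_EFinP; exact: measurableT_comp.
have -> : distribution P Zm (xsection C' x) =
    \int[lebesgue_measure]_(a in xsection C x) (kappa (x, a))%:E.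
  have mCx : measurable (xsection C x) by exact: measurable_xsection.
  rewrite -(phikappa x gx0 _ mCx).
  by transitivity (P (X i @^-1` xsection C' x)).
rewrite muleC -ge0_integralZl.
- rewrite integral_mkcond; apply: eq_integral => a _.
  by rewrite !patchE mem_xsection.
- by have := measurable_xsection x mC.
- by apply: measurable_funTS; exact: mk.
- by move=> a _; rewrite lee_fin.
- by rewrite lee_fin.
Qed.

End pair.

(** Each move of the chain supersedes the older coordinate, which Tonelli integrates out here. *)
Lemma has_density_marginal {d1 d2 d3} {T1 : measurableType d1}
    {T2 : measurableType d2} {T3 : measurableType d3}
    (m1 : {sigma_finite_measure set T1 -> \bar R})
    (m2 : {sigma_finite_measure set T2 -> \bar R})
    (m3 : {sigma_finite_measure set T3 -> \bar R})
    (A : T -> T1) (B : T -> T2) (C : T -> T3) (f : (T1 * T2) * T3 -> R)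
    (h : T2 * T3 -> R) :
  has_density (sigma_finite_prod m1 m2 \x m3) (fun w => ((A w, B w), C w)) f ->
  measurable_fun setT h -> (forall x, (0 <= h x)%R) ->
  (forall b c, \int[m1]_a (f ((a, b), c))%:E = (h (b, c))%:E) ->
  has_density (m2 \x m3) (fun w => (B w, C w)) h.
Proof.
move=> [mABC mf f0 fE] mh h0 hE.
have [/= mAB mC] := (@measurable_fun_pairP _ _ _ _ _ _ _).1 mABC.
have [/= mA mB] := (@measurable_fun_pairP _ _ _ _ _ _ _).1 mAB.
split => //; first exact: measurable_fun_pair.
move=> D mD; pose pi := fun q : (T1 * T2) * T3 => (q.1.2, q.2).
have mpi : measurable_fun setT pi.
  by apply: measurable_fun_pair => //; exact: measurableT_comp.
have mD' : measurable (pi @^-1` D) by rewrite -[X in measurable X]setTI; exact: mpi.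
rewrite (_ : _ @^-1` D = (fun w => ((A w, B w), C w)) @^-1` (pi @^-1` D))// fE//.
have mfD : measurable_fun setT ((fun q => (f q)%:E) \_ (pi @^-1` D)).
  apply/measurable_restrict => //; exact/measurable_funTS/measurable_EFinP.
have mhD : measurable_fun setT ((fun q => (h q)%:E) \_ D).
  apply/measurable_restrict => //; exact/measurable_funTS/measurable_EFinP.
have fD0 q : 0 <= ((fun q => (f q)%:E) \_ (pi @^-1` D)) q.
  by rewrite patchE; case: ifP => // _; rewrite lee_fin.
have hD0 q : 0 <= ((fun q => (h q)%:E) \_ D) q.
  by rewrite patchE; case: ifP => // _; rewrite lee_fin.
(* The order of integration is c, b, then a innermost: for fixed (b, c) the indicator of D does not
   depend on a. *)
rewrite [LHS]integral_mkcond [RHS]integral_mkcond.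
rewrite (@fubini_tonelli2 _ _ (T1 * T2)%type T3 R (sigma_finite_prod m1 m2) m3 _
    mfD fD0).
rewrite (@fubini_tonelli2 _ _ _ _ R m2 m3 _ mhD hD0).
apply: eq_integral => c _; rewrite /fubini_G /=.
rewrite (@fubini_tonelli2 _ _ _ _ R m1 m2)//=; last first.
  exact: (measurable_fun_pair1 c mfD).
apply: eq_integral => b _; rewrite /fubini_G patchE.
have [bcD|bcD] := boolP ((b, c) \in D).
  rewrite -hE; apply: eq_integral => a _.
  by rewrite patchE ifT//; move: bcD; rewrite !inE.
rewrite integral0_eq// => a _; rewrite patchE ifF//.
by apply/negbTE; move: bcD; apply: contra; rewrite !inE.
Qed.

End density.

(** * Uniform and exponential steps *)

Section affine_substitution.
Local Open Scope ereal_scope.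
Context {R : realType}.
Local Notation mu := lebesgue_measure.

(** Lebesgue measure is 1/b times its own image under x -> (x - a) / b: this is checked on half-open
    intervals, which determine it. *)
Lemma ge0_integral_affine (a b : R) (G : R -> \bar R) : (0 < b)%R ->
  measurable_fun setT G -> (forall x, 0 <= G x) ->
  \int[mu]_z G z = (b^-1)%:E * \int[mu]_x G ((x - a) / b)%R.
Proof.
move=> b0 mG G0.
pose psi : measurableTypeR R -> measurableTypeR R := fun x => ((x - a) / b)%R.
have mpsi : measurable_fun setT psi.
  by apply: measurable_funM => //; exact: measurable_funB.
pose m' := measure_function_pushforward__canonical__measure_function_Measure mu mpsi.
have b'0 : (0 <= b^-1)%R by rewrite invr_ge0 ltW.
have muE A : measurable A -> mu A = mscale (NngNum b'0) m' A.
  apply: lebesgue_measure_unique => _ [[x y] _ <-].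
  have pre : psi @^-1` `]x, y] = `](a + b * x)%R, (a + b * y)%R]%classic.
    apply/seteqP; split => z; rewrite /psi /= !in_itv/=.
      rewrite ltr_pdivlMr// ler_pdivrMr// => /andP[? ?].
      by apply/andP; split; lra.
    rewrite ltr_pdivlMr// ler_pdivrMr// => /andP[? ?].
    by apply/andP; split; lra.
  transitivity ((b^-1)%:E * mu (psi @^-1` `]x, y])); last by [].
  rewrite pre !lebesgue_measure_itv/= !lte_fin ltrD2l ltr_pM2l//.
  case: ifPn => _; last by rewrite mule0.
  rewrite -!EFinD -EFinM; congr EFin; field.
  by rewrite gt_eqF.
rewrite (eq_measure_integral (mscale (NngNum b'0) m')); last first.
  by move=> A mA _; exact: muE.
rewrite ge0_integral_mscale//=; congr (_ * _).
by rewrite (ge0_integral_pushforward mpsi)//= preimage_setT.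
Qed.

(** One statement serves both moves: a = t, b = 1/y for the waiting time, and a = 0, b = y for the
    drop. *)
Lemma affine_density {d} {T : measurableType d} (P : probability T R)
    (Z : T -> R) (f : R -> R) (a b : R) (C : set R) :
  (0 < b)%R -> has_density P mu Z f -> measurable C ->
  P [set w | C (a + b * Z w)%R] =
  \int[mu]_(x in C) (f ((x - a) / b) / b)%:E.
Proof.
move=> b0 [mZ mf f0 Zf] mC.
pose C' := [set z | C (a + b * z)%R].
have mC' : measurable C'.
  have maff : measurable_fun setT (fun z : R => a + b * z)%R.
    by apply: measurable_funD => //; exact: measurable_funM.
  by rewrite -[X in measurable X]setTI; exact: maff.
rewrite (_ : [set w | _] = Z @^-1` C')// Zf// integral_mkcond.
rewrite (ge0_integral_affine a b)//; last 2 first.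
- by apply/measurable_restrict => //; exact/measurable_funTS/measurable_EFinP.
- by move=> x; rewrite patchE; case: ifP => // _; rewrite lee_fin.
have mfab : measurable_fun [set: R] (fun x : R => (f ((x - a) / b))%:E).
  apply/measurable_EFinP; apply: (measurableT_comp (mf : measurable_fun [set: R] f)).
  by apply: measurable_funM => //; exact: measurable_funB.
have CC' (x : R) : ((x - a) / b \in C')%R = (x \in C).
  have -> // : (x \in C) = (a + b * ((x - a) / b) \in C)%R.
  by congr (_ \in C); field; rewrite gt_eqF.
transitivity ((b^-1)%:E * \int[mu]_(x in C) (f ((x - a) / b))%:E).
  congr (_ * _); rewrite [RHS]integral_mkcond; apply: eq_integral => x _.
  by rewrite !patchE CC'.
rewrite -ge0_integralZl//.
- by apply: eq_integral => x _; rewrite -EFinM mulrC.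
- exact: measurable_funTS.
- by move=> x _; rewrite lee_fin.
- by rewrite lee_fin invr_ge0 ltW.
Qed.

(** The points 0 and 1 are the only ones where [uniform_pdf] and [exponential_pdf] may differ from
    the densities with open supports below. *)
Lemma eq_integral_off01 (f g : R -> R) (A : set R) : measurable A ->
  measurable_fun setT f -> measurable_fun setT g ->
  (forall x, (0 <= f x)%R) -> (forall x, (0 <= g x)%R) ->
  (forall x, x != 0%R -> x != 1%R -> f x = g x) ->
  \int[mu]_(x in A) (f x)%:E = \int[mu]_(x in A) (g x)%:E.
Proof.
move=> mA mf mg f0 g0 fg; apply: ge0_ae_eq_integral => //.
- exact/measurable_funTS/measurable_EFinP.
- exact/measurable_funTS/measurable_EFinP.
- by move=> x _; rewrite lee_fin.
- by move=> x _; rewrite lee_fin.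
exists [set 0%R; 1%R]; split.
- exact: measurableU.
- by apply: countable_lebesgue_measure0; apply: finite_set_countable;
    rewrite finite_setU.
move=> x /=; apply: contra_notP => /not_orP[/eqP x0 /eqP x1] Ax.
by rewrite fg.
Qed.

(* Open supports keep the level positive and make the marginalisation
   identities below hold at every point. *)
Definition uniform_density (x : R) : R := if (0 < x < 1)%R then 1%R else 0%R.
Definition exponential_density (x : R) : R := if (0 < x)%R then expR (- x) else 0%R.

Lemma measurable_uniform_density : measurable_fun setT uniform_density.
Proof.
apply: measurable_fun_ifT => //.
by apply: measurable_and; apply: measurable_fun_ltr.
Qed.

Lemma measurable_exponential_density : measurable_fun setT exponential_density.
Proof.
apply: measurable_fun_ifT => //; first exact: measurable_fun_ltr.
apply: continuous_measurable_fun; exact: continuous_expRN.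
Qed.

Lemma uniform_density_ge0 x : (0 <= uniform_density x)%R.
Proof. by rewrite /uniform_density; case: ifP. Qed.

Lemma exponential_density_ge0 x : (0 <= exponential_density x)%R.
Proof. by rewrite /exponential_density; case: ifP => // _; rewrite expR_ge0. Qed.

Lemma uniform_prob_density A : measurable A ->
  uniform_prob (@ltr01 R) A = \int[mu]_(x in A) (uniform_density x)%:E.
Proof.
move=> mA; rewrite /uniform_prob; apply: eq_integral_off01 => //.
- exact: measurable_uniform_pdf.
- exact: measurable_uniform_density.
- by move=> x; exact: uniform_pdf_ge0.
- exact: uniform_density_ge0.
move=> x x0 x1; rewrite /uniform_pdf /uniform_density subr0 invr1.
by rewrite !lt_neqAle eq_sym x0 x1.
Qed.

Lemma exponential_prob_density A : measurable A ->
  exponential_prob (1 : R) A = \int[mu]_(x in A) (exponential_density x)%:E.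
Proof.
move=> mA; rewrite /exponential_prob; apply: eq_integral_off01 => //.
- exact: measurable_exponential_pdf.
- exact: measurable_exponential_density.
- by move=> x; exact: exponential_pdf_ge0.
- exact: exponential_density_ge0.
move=> x x0 _; rewrite /exponential_density lt_neqAle eq_sym x0/=.
case: ifPn => [x0'|]; first by rewrite exponential_pdfE// mul1r mulN1r.
by rewrite -ltNge => ?; rewrite lt0_exponential_pdf.
Qed.

End affine_substitution.

(** * Joint densities and the two transition kernels *)

Section record_densities.
Context {R : realType}.
Local Notation mu := lebesgue_measure.
Implicit Types (t y x : R).

(** Densities are conditionals on the whole line; endpoints being null, one formula covers every
    kind of bounded interval. *)
Lemma FTC_if_itv {f F : R -> R} {a b : R} (b0 b1 : bool) : a <= b ->
  continuous f -> (forall x, is_derive x 1 F (f x)) ->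
  (\int[mu]_x (if x \in Interval (BSide b0 a) (BSide b1 b) then f x else 0)%:E =
   (F b - F a)%:E)%E.
Proof.
move=> ab cf dF; rewrite -(FTC_closed ab cf dF).
have mf : measurable_fun `]a, b[ (fun x => (f x)%:E).
  by apply/measurable_EFinP/measurable_funTS; exact: continuous_measurable_fun.
rewrite (integral_itv_bndoo true false mf) -(integral_itv_bndoo b0 b1 mf).
rewrite [RHS]integral_mkcond; apply: eq_integral => x _.
by rewrite patchE mem_setE; case: ifP.
Qed.

Lemma FTC_if_oo {f F : R -> R} {a b : R} : a <= b -> continuous f ->
  (forall x, is_derive x 1 F (f x)) ->
  (\int[mu]_x (if a < x < b then f x else 0)%:E = (F b - F a)%:E)%E.
Proof.
move=> ab cf dF; rewrite -(FTC_if_itv false true ab cf dF).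
by apply: eq_integral => x _; rewrite in_itv.
Qed.

(* In the notation of the header, [density_SW k] is the density of
   (S_{k+1}, W_{k+1}) and [density_WS k] that of (W_k, S_{k+1}). *)
Definition density_SW k (p : R * R) : R :=
  if (0 < p.1) && (0 < p.2 < 1)
  then expR (- (p.1 * p.2)) * ((1 - p.2) * q_ext k (p.1 * (1 - p.2))) else 0.

Definition density_WS k (p : R * R) : R :=
  if (0 < p.2) && (0 < p.1 < 1)
  then p.1 * (expR (- (p.2 * p.1)) * q_prim k (p.2 * (1 - p.1))) else 0.

(* Conditional densities at [p.2] of t + E / y given [p.1 = (t, y)], and of
   y * V given [p.1 = (y, t)]. *)
Definition wait_kernel (p : (R * R) * R) : R :=
  if 0 < p.1.2 then exponential_density ((p.2 - p.1.1) * p.1.2) * p.1.2 else 0.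

Definition drop_kernel (p : (R * R) * R) : R :=
  if 0 < p.1.1 then uniform_density (p.2 / p.1.1) / p.1.1 else 0.

Lemma density_SW_ge0 k p : 0 <= density_SW k p.
Proof.
rewrite /density_SW; case: ifPn => // /andP[t0 /andP[y0 y1]].
apply: mulr_ge0; first exact: expR_ge0.
apply: mulr_ge0; first by rewrite subr_ge0 ltW.
by apply: q_ext_ge0; apply: mulr_ge0; rewrite ?subr_ge0 ltW.
Qed.

Lemma density_WS_ge0 k p : 0 <= density_WS k p.
Proof.
rewrite /density_WS; case: ifPn => // /andP[t0 /andP[y0 y1]].
apply: mulr_ge0; first exact: ltW.
apply: mulr_ge0; first exact: expR_ge0.
by apply: q_prim_ge0; apply: mulr_ge0; rewrite ?subr_ge0 ltW.
Qed.

Lemma wait_kernel_ge0 p : 0 <= wait_kernel p.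
Proof.
by rewrite /wait_kernel; case: ifPn => // p0;
    rewrite mulr_ge0 ?exponential_density_ge0// ltW.
Qed.

Lemma drop_kernel_ge0 p : 0 <= drop_kernel p.
Proof.
by rewrite /drop_kernel; case: ifPn => // p0;
    rewrite divr_ge0 ?uniform_density_ge0// ltW.
Qed.

(** Inversion is discontinuous at 0, so it is written piecewise through exp and ln, with the
    convention that 0 has inverse 0. *)
Lemma measurable_invr : measurable_fun [set: R] (fun x : R => x^-1).
Proof.
have -> : (fun x : R => x^-1) = (fun x => if 0 < x then expR (- ln x) else
    if x < 0 then - expR (- ln (- x)) else 0).
  apply/funext => x; have [x0|x0|<-] := ltgtP 0 x; last by rewrite invr0.
  - by rewrite expRN lnK ?posrE.
  - by rewrite expRN lnK ?posrE ?oppr_gt0// invrN opprK.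
have mexp (f : R -> R) : measurable_fun setT f ->
    measurable_fun setT (fun x => expR (- f x)).
  by move=> mf; apply: (measurableT_comp (continuous_measurable_fun continuous_expRN)).
apply: measurable_fun_ifT; first exact: measurable_fun_ltr.
  by apply: mexp; exact: measurable_ln.
apply: measurable_fun_ifT => //; first exact: measurable_fun_ltr.
apply: measurable_funN; apply: mexp.
by apply: measurableT_comp; [exact: measurable_ln|exact: measurable_funN].
Qed.

Lemma measurable_density_SW k : measurable_fun setT (density_SW k).
Proof.
apply: measurable_fun_ifT => //.
  apply: measurable_and; first exact: measurable_fun_ltr.
  by apply: measurable_and; exact: measurable_fun_ltr.
have m1 : measurable_fun setT (fun p : R * R => 1 - p.2).
  exact: measurable_funB.
apply: measurable_funM.
  apply: (measurableT_comp (continuous_measurable_fun continuous_expRN)).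
  exact: measurable_funM.
apply: measurable_funM => //.
apply: (measurableT_comp (continuous_measurable_fun (continuous_q_ext k))).
exact: measurable_funM.
Qed.

Lemma measurable_density_WS k : measurable_fun setT (density_WS k).
Proof.
apply: measurable_fun_ifT => //.
  apply: measurable_and; first exact: measurable_fun_ltr.
  by apply: measurable_and; exact: measurable_fun_ltr.
have m1 : measurable_fun setT (fun p : R * R => 1 - p.1).
  exact: measurable_funB.
apply: measurable_funM => //; apply: measurable_funM.
  apply: (measurableT_comp (continuous_measurable_fun continuous_expRN)).
  exact: measurable_funM.
apply: (measurableT_comp (continuous_measurable_fun (continuous_q_prim k))).
exact: measurable_funM.
Qed.

Lemma measurable_wait_kernel : measurable_fun setT wait_kernel.
Proof.
have m12 : measurable_fun setT (fun p : (R * R) * R => p.1.2).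
  exact: measurableT_comp.
have m11 : measurable_fun setT (fun p : (R * R) * R => p.1.1).
  exact: measurableT_comp.
apply: measurable_fun_ifT => //; first exact: measurable_fun_ltr.
apply: measurable_funM => //; apply: (measurableT_comp measurable_exponential_density).
by apply: measurable_funM => //; exact: measurable_funB.
Qed.

Lemma measurable_drop_kernel : measurable_fun setT drop_kernel.
Proof.
have m11 : measurable_fun setT (fun p : (R * R) * R => p.1.1).
  exact: measurableT_comp.
have mV : measurable_fun setT (fun p : (R * R) * R => (p.1.1)^-1).
  exact: (measurableT_comp measurable_invr).
apply: measurable_fun_ifT => //; first exact: measurable_fun_ltr.
apply: measurable_funM => //; apply: (measurableT_comp measurable_uniform_density).
exact: measurable_funM.
Qed.

Lemma is_derive_const (c x : R) : is_derive x 1 (fun=> c) 0.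
Proof. exact: is_derive_cst. Qed.

Lemma is_derive_scale_sub (t y : R) : is_derive y 1 (fun z => t * (1 - z)) (- t).
Proof.
apply: (is_derive_eq (is_derive_mul (is_derive_const t y)
  (is_derive_add (is_derive_const 1 y) (is_deriveNid y 1)))).
by ring.
Qed.

Lemma is_derive_scale (c t : R) : is_derive t 1 (fun z => z * c) c.
Proof.
apply: (is_derive_eq (is_derive_mul (is_derive_id t 1) (is_derive_const c t))).
by ring.
Qed.

(** With x = t(1-y), differentiation produces x q_k + (q_k + x q_k'), and the bracket is p_k by
    [q_ext_ode]. *)
Lemma is_derive_density_SW k (t y : R) :
  is_derive y 1 (fun z => - (expR (- (t * z)) * ((1 - z) * q_ext k (t * (1 - z)))))
    (expR (- (t * y)) * q_prim k (t * (1 - y))).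
Proof.
have dt : is_derive y 1 (fun z => t * z) t.
  apply: (is_derive_eq (is_derive_mul (is_derive_const t y) (is_derive_id y 1))).
  by ring.
have d1 : is_derive y 1 (fun z : R => 1 - z) (-1).
  apply: (is_derive_eq (is_derive_add (is_derive_const 1 y) (is_deriveNid y 1))).
  by ring.
apply: (is_derive_eq (is_deriveN (is_derive_mul
  (is_derive_comp_mul (is_derive_expRN _) dt) (is_derive_mul d1
  (is_derive_comp_mul (is_derive_q_ext k _) (is_derive_scale_sub t y)))))).
by rewrite /q_prim -q_ext_ode; ring.
Qed.

Lemma continuous_affine_comp (f : R -> R) (a b : R) : continuous f ->
  continuous (fun x => f (a * (b - x))).
Proof.
move=> cf x; apply: (@continuous_comp _ _ _ (fun x => a * (b - x)) f); last exact: cf.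
by apply: cvgM; [exact: cvg_cst|apply: cvgB; [exact: cvg_cst|exact: cvg_id]].
Qed.

Lemma continuous_scale_comp (f : R -> R) (a : R) : continuous f ->
  continuous (fun x => f (x * a)).
Proof.
move=> cf x; apply: (@continuous_comp _ _ _ (fun x => x * a) f); last exact: cf.
by apply: cvgM; [exact: cvg_id|exact: cvg_cst].
Qed.

(** The kernel is 1/y for 0 < y' < y and cancels the factor y of [density_WS]. The rest is a
    derivative in y, integrated from y' to 1. *)
Lemma drop_marginal k t y' :
  (\int[mu]_y (density_WS k (y, t) * drop_kernel ((y, t), y'))%:E =
      (density_SW k (t, y'))%:E)%E.
Proof.
rewrite /density_SW /=; case: ifPn => [/andP[t0 /andP[y0 y1]]|h].
  rewrite -[RHS]/((_ : R)%:E).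
  have cf : continuous (fun y => expR (- (t * y)) * q_prim k (t * (1 - y))).
    move=> x; apply: cvgM; last exact: (continuous_affine_comp _ _ _
        (continuous_q_prim k)).
    under eq_cvg do rewrite mulrC.
    rewrite mulrC; exact: (continuous_scale_comp _ _ continuous_expRN).
  (* The boundary term at 1 is zero thanks to its factor 1 - 1. *)
  rewrite (_ : expR _ * _ = - (expR (- (t * 1)) * ((1 - 1) * q_ext k (t * (1 - 1)))) -
      - (expR (- (t * y')) * ((1 - y') * q_ext k (t * (1 - y'))))); last by ring.
  rewrite -(FTC_if_oo (ltW y1) cf (is_derive_density_SW k t)).
  apply: eq_integral => y _; congr EFin.
  rewrite /density_WS /drop_kernel /uniform_density /= t0/=.
  have [y'y|yy'] := ltP y' y; rewrite /=; last first.
    case: ifPn => [/andP[y0' y1']|_]; last by rewrite mul0r.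
    by rewrite y0' ltr_pdivrMr// mul1r [y' < y]ltNge yy' andbF mul0r mulr0.
  have y00 : 0 < y by exact: lt_trans y'y.
  rewrite y00 ltr_pdivrMr// mul1r y'y divr_gt0//=.
  case: ifPn => _; last by rewrite mul0r.
  by field; rewrite gt_eqF.
apply: integral0_eq => y _; rewrite [LHS](_ : _ = 0%:E)//; congr EFin;
    rewrite /density_WS /drop_kernel /uniform_density /=.
case: ifPn => [/andP[t0 /andP[y0 y1]]|]; last by rewrite mul0r.
rewrite y0 /=; case: ifPn => [|_]; last by rewrite mul0r mulr0.
rewrite ltr_pdivrMr// pmulr_lgt0 ?invr_gt0// => /andP[y0' yy'].
by rewrite mul1r in yy'; move: h; rewrite t0 y0' (lt_trans yy' y1).
Qed.

(** The exponentials e^{-ty} and e^{-(t'-t)y} combine to e^{-t'y}, free of t. Only (1-y) q_k(t(1-y))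
    is left to integrate over 0 < t < t', and its primitive vanishes at t = 0 by [q_primS_at0]. *)
Lemma wait_marginal k y t' :
  (\int[mu]_t (density_SW k (t, y) * wait_kernel ((t, y), t'))%:E =
      (density_WS k.+1 (y, t'))%:E)%E.
Proof.
rewrite /density_WS /=; case: ifPn => [/andP[t0 /andP[y0 y1]]|h].
  pose c := y * expR (- (t' * y)).
  have cf : continuous (fun t => c * ((1 - y) * q_ext k (t * (1 - y)))).
    move=> x; apply: cvgM; first exact: cvg_cst.
    apply: cvgM; first exact: cvg_cst.
    exact: (continuous_scale_comp _ _ (continuous_q_ext k)).
  have dF t : is_derive t 1 (fun t => c * q_prim k.+1 (t * (1 - y)))
      (c * ((1 - y) * q_ext k (t * (1 - y)))).
    apply: (is_derive_eq (is_derive_mul (is_derive_const c t)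
      (is_derive_comp_mul (is_derive_q_primS k _) (is_derive_scale (1 - y) t)))).
    by ring.
  rewrite (_ : y * _ = c * q_prim k.+1 (t' * (1 - y)) - c * q_prim k.+1 (0 * (1
      - y))); last first.
    by rewrite mul0r q_primS_at0 /c; ring.
  rewrite -(FTC_if_oo (ltW t0) cf dF).
  apply: eq_integral => t _; congr EFin.
  rewrite /density_SW /wait_kernel /exponential_density /= y0 y1 /= pmulr_lgt0//
      subr_gt0 !andbT.
  have [tp|tp] /= := ltP 0 t; last by rewrite mul0r.
  have [tt'|tt'] /= := ltP t t'; last by rewrite mul0r mulr0.
  rewrite /c (_ : - (t' * y) = - (t * y) + - ((t' - t) * y)); last by ring.
  by rewrite expRD; ring.
apply: integral0_eq => t _; rewrite [LHS](_ : _ = 0%:E)//; congr EFin;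
    rewrite /density_SW /wait_kernel /exponential_density /=.
case: ifPn => [/andP[t0 /andP[y0 y1]]|]; last by rewrite mul0r.
rewrite y0 /= pmulr_lgt0// subr_gt0; case: ifPn => tt'; last by rewrite mul0r mulr0.
by move: h; rewrite y0 y1 (lt_trans t0 tt').
Qed.

End record_densities.

(** * The joint law of record times and values *)

Section record_chain.
Context {R : realType} {d : measure_display} {T : measurableType d}.
Variables (P : probability T R) (V E : nat -> T -> R).
Local Notation mu := (@lebesgue_measure R).
Local Notation X := (joint_family V E).
Hypothesis densV : forall j, has_density P mu (V j) uniform_density.
Hypothesis densE : forall j, has_density P mu (E j) exponential_density.
Hypothesis hind : mutually_independent P X.

Lemma measurable_joint i : measurable_fun setT (X i).
Proof. by case: i => j; [have [] := densV j|have [] := densE j]. Qed.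

(** The common form of the two moves: a fresh variable X i adds a coordinate, the older one is
    integrated out, and i leaves the set of free variables. *)
Lemma record_step (A B : T -> R) (g h : R * R -> R) i (D D' : pred (nat + nat))
    (phi kappa : (R * R) * R -> R) :
  has_density P (mu \x mu)%E (fun w => (A w, B w)) g ->
  indep_of P X D (fun w => (A w, B w)) -> D i ->
  (forall j, D' j -> D j && (j != i)) ->
  measurable_fun setT phi -> measurable_fun setT kappa ->
  (forall p, 0 <= kappa p) ->
  (forall x, g x != 0 -> forall C, measurable C ->
    P [set w | C (phi (x, X i w))] = (\int[mu]_(a in C) (kappa (x, a))%:E)%E) ->
  measurable_fun setT h -> (forall x, 0 <= h x) ->
  (forall b c, (\int[mu]_a (g (a, b) * kappa ((a, b), c))%:E = (h (b, c))%:E)%E) ->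
  has_density P (mu \x mu)%E (fun w => (B w, phi ((A w, B w), X i w))) h /\
  indep_of P X D' (fun w => (B w, phi ((A w, B w), X i w))).
Proof.
move=> gAB iAB Di DD' mphi mkappa kappa0 phikappa mh h0 hE; split.
  have := @has_density_extend _ _ _ P _ X measurable_joint _ _
    (sigma_finite_prod mu mu) _ g i D phi kappa gAB iAB Di mphi mkappa kappa0 phikappa.
  move=> ext; exact: (@has_density_marginal _ _ _ P _ _ _ _ _ _ mu mu mu A B _ _ h ext).
have [mAB _ _ _] := gAB.
have := @indep_of_pair _ _ _ P _ X measurable_joint hind _ _ _ i D D' mAB iAB Di DD'.
have mpi : measurable_fun setT (fun q : (R * R) * R => (q.1.2, phi q)).
  by apply: measurable_fun_pair => //; exact: measurableT_comp.
by move/(indep_of_comp P X D' _ _ mpi).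
Qed.

Let W k w : R := \prod_(m < k.+1) V m w.
Let S k w : R := \sum_(i < k) E i w / \prod_(m < i.+1) V m w.

(* The variables not used by (W_k, S_{k+1}), resp. (S_{k+1}, W_{k+1}). *)
Let freeH k (i : nat + nat) :=
  match i with inl j => (k < j)%N | inr j => (k < j)%N end.
Let freeG k (i : nat + nat) :=
  match i with inl j => (k.+1 < j)%N | inr j => (k < j)%N end.

(** The initial state is U alone, so nothing has to be integrated out: one wait from time 0 at level
    y gives the density y e^{-ty}, which is [density_WS 0] because [q_prim 0] is 1. *)
Lemma density_base :
  has_density P (mu \x mu)%E (fun w => (W 0 w, S 1 w)) (density_WS 0) /\
  indep_of P X (freeH 0) (fun w => (W 0 w, S 1 w)).
Proof.
pose D0 (i : nat + nat) := if i is inl j then (0 < j)%N else true.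
have iV : indep_of P X D0 (V 0).
  exact: (@indep_of_family _ _ _ P _ X hind (inl 0%N) D0).
pose phi (p : R * R) : R := p.2 / p.1.
have mphi : measurable_fun setT phi.
  by apply: measurable_funM => //; exact: (measurableT_comp measurable_invr).
pose kappa (p : R * R) : R := wait_kernel ((0, p.1), p.2).
have mkappa : measurable_fun setT kappa.
  apply: (measurableT_comp measurable_wait_kernel).
  by apply: measurable_fun_pair => //; exact: measurable_fun_pair.
have phikappa x : uniform_density x != 0 -> forall C, measurable C ->
    P [set w | C (phi (x, E 0%N w))] = (\int[mu]_(a in C) (kappa (x, a))%:E)%E.
  rewrite /uniform_density; case: ifPn => [/andP[x0 _] _ C mC|]; last by rewrite eqxx.
  have xV : 0 < x^-1 by rewrite invr_gt0.
  rewrite (_ : [set w | _] = [set w | C (0 + x^-1 * E 0%N w)]); last first.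
    by apply/seteqP; split => w /=; rewrite /phi/= add0r mulrC.
  rewrite (affine_density _ _ _ 0 _ _ xV (densE 0)) //.
  by apply: eq_integral => a _; rewrite /kappa /wait_kernel /= x0 invrK.
have ext := @has_density_extend _ _ _ P _ X measurable_joint _ _ mu (V 0)
    uniform_density
  (inr 0%N) D0 phi kappa (densV 0) iV isT mphi mkappa (fun p => wait_kernel_ge0
      _) phikappa.
have fE : (fun w => (V 0%N w, phi (V 0%N w, X (inr 0%N) w))) =
    (fun w => (W 0 w, S 1 w)).
  by apply/funext => w; rewrite /W /S !big_ord1.
split.
  rewrite -fE (_ : density_WS 0 = (fun p => uniform_density p.1 * kappa p)) //.
  apply/funext => -[y t]; rewrite /density_WS /uniform_density /kappa
      /wait_kernel /exponential_density /= subr0 q_prim0 mulr1.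
  have [y0|y0] /= := ltP 0 y; last by rewrite andbF mul0r.
  have [y1|y1] /= := ltP y 1; last by rewrite andbF mul0r.
  rewrite andbT pmulr_lgt0//; case: ifPn => _; last by rewrite mul0r mulr0.
  by rewrite mul1r mulrC.
rewrite -fE.
have [mV _ _ _] := densV 0.
have DD' j : freeH 0 j -> D0 j && (j != inr 0%N) by case: j => [j|[|j]] //= ->.
have := @indep_of_pair _ _ _ P _ X measurable_joint hind _ _ (V 0) (inr 0%N) D0
    _ mV iV isT DD'.
have mpi : measurable_fun setT (fun q : R * R => (q.1, phi q)).
  exact: measurable_fun_pair.
by move/(indep_of_comp P X _ _ _ mpi).
Qed.

(** The drop W_{k+1} = W_k U_{k+1} consumes the uniform variable of index k+1. *)
Lemma density_stepV k :
  has_density P (mu \x mu)%E (fun w => (W k w, S k.+1 w)) (density_WS k) /\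
  indep_of P X (freeH k) (fun w => (W k w, S k.+1 w)) ->
  has_density P (mu \x mu)%E (fun w => (S k.+1 w, W k.+1 w)) (density_SW k) /\
  indep_of P X (freeG k) (fun w => (S k.+1 w, W k.+1 w)).
Proof.
move=> [hH iH].
pose phi (p : (R * R) * R) : R := p.1.1 * p.2.
have mphi : measurable_fun setT phi.
  by apply: measurable_funM => //; exact: measurableT_comp.
have phikappa x : density_WS k x != 0 -> forall C, measurable C ->
    P [set w | C (phi (x, X (inl k.+1) w))] =
        (\int[mu]_(a in C) (drop_kernel (x, a))%:E)%E.
  rewrite /density_WS; case: ifPn => [/andP[_ /andP[x0 _]] _ C mC|];
      last by rewrite eqxx.
  rewrite (_ : [set w | _] = [set w | C (0 + x.1 * V k.+1 w)]); last first.
    by apply/seteqP; split => w /=; rewrite /phi/= add0r.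
  rewrite (affine_density _ _ _ 0 _ _ x0 (densV k.+1)) //.
  by apply: eq_integral => a _; rewrite /drop_kernel /= x0 subr0.
have DD' j : freeG k j -> freeH k j && (j != inl k.+1).
  case: j => [j|j] /=; last by rewrite andbT.
  by move=> kj; rewrite (ltn_trans _ kj)//=; apply/eqP => -[jk]; rewrite jk ltnn in kj.
have := @record_step _ _ (density_WS k) (density_SW k) (inl k.+1) (freeH k)
    (freeG k) phi drop_kernel
  hH iH (ltnSn k) DD' mphi measurable_drop_kernel drop_kernel_ge0 phikappa
      (measurable_density_SW k)
  (density_SW_ge0 k) (drop_marginal k).
rewrite (_ : (fun w => _) = (fun w => (S k.+1 w, W k.+1 w)))//.
by apply/funext => w; rewrite /W [in RHS]big_ord_recr.
Qed.

(** The wait S_{k+2} = S_{k+1} + E_{k+2} / W_{k+1} consumes [E k.+1], which is E_{k+2} in the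
    numbering from 1. *)
Lemma density_stepE k :
  has_density P (mu \x mu)%E (fun w => (S k.+1 w, W k.+1 w)) (density_SW k) /\
  indep_of P X (freeG k) (fun w => (S k.+1 w, W k.+1 w)) ->
  has_density P (mu \x mu)%E (fun w => (W k.+1 w, S k.+2 w)) (density_WS k.+1) /\
  indep_of P X (freeH k.+1) (fun w => (W k.+1 w, S k.+2 w)).
Proof.
move=> [hG iG].
pose phi (p : (R * R) * R) : R := p.1.1 + p.2 / p.1.2.
have mphi : measurable_fun setT phi.
  apply: measurable_funD; first exact: measurableT_comp.
  apply: measurable_funM => //; apply: (measurableT_comp measurable_invr).
  exact: measurableT_comp.
have phikappa x : density_SW k x != 0 -> forall C, measurable C ->
    P [set w | C (phi (x, X (inr k.+1) w))] =
        (\int[mu]_(a in C) (wait_kernel (x, a))%:E)%E.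
  rewrite /density_SW; case: ifPn => [/andP[_ /andP[x0 _]] _ C mC|];
      last by rewrite eqxx.
  have xV : 0 < x.2^-1 by rewrite invr_gt0.
  rewrite (_ : [set w | _] = [set w | C (x.1 + x.2^-1 * E k.+1 w)]); last first.
    by apply/seteqP; split => w /=; rewrite /phi/= [in X in _ + X]mulrC.
  rewrite (affine_density _ _ _ _ _ _ xV (densE k.+1)) //.
  by apply: eq_integral => a _; rewrite /wait_kernel /= x0 invrK.
have DD' j : freeH k.+1 j -> freeG k j && (j != inr k.+1).
  case: j => [j|j] /=; first by rewrite andbT.
  by move=> kj; rewrite (ltn_trans _ kj)//=; apply/eqP => -[jk]; rewrite jk ltnn in kj.
have := @record_step _ _ (density_SW k) (density_WS k.+1) (inr k.+1) (freeG k)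
    (freeH k.+1) phi wait_kernel
  hG iG (ltnSn k) DD' mphi measurable_wait_kernel wait_kernel_ge0 phikappa
      (measurable_density_WS k.+1)
  (density_WS_ge0 k.+1) (wait_marginal k).
rewrite (_ : (fun w => _) = (fun w => (W k.+1 w, S k.+2 w)))//.
by apply/funext => w; rewrite /S [in RHS]big_ord_recr.
Qed.

Lemma record_density k :
  has_density P (mu \x mu)%E (fun w =>
    (\sum_(i < k.+1) E i w / \prod_(m < i.+1) V m w, \prod_(m < k.+2) V m w))
        (density_SW k).
Proof.
suff : has_density P (mu \x mu)%E (fun w => (W k w, S k.+1 w)) (density_WS k) /\
    indep_of P X (freeH k) (fun w => (W k w, S k.+1 w)).
  by move/density_stepV => [].
elim: k => [|k IH]; first exact: density_base.
exact/density_stepE/density_stepV.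
Qed.

End record_chain.

(** * Integration of the joint density over the event t(1-y) <= s *)

Section final_integral.
Context {R : realType}.
Local Notation mu := (@lebesgue_measure R).
Implicit Types (s t y : R).

(** Since ty + t(1-y) = t, the exponentials leave e^{-t} (1-y) [exp_q k (t(1-y))]. Its primitive in
    y is -e^{-t} / t^2 times [weighted_q_prim k.+1 (t(1-y))], one factor t coming from the weight
    and one from the chain rule. *)
Lemma integral_density_SW_itv k (t a : R) (b0 : bool) : 0 < t -> a <= 1 ->
  (\int[mu]_y (if y \in Interval (BSide b0 a) (BLeft 1)
     then expR (- (t * y)) * ((1 - y) * q_ext k (t * (1 - y))) else 0)%:E =
   (expR (- t) * (weighted_q_prim k.+1 (t * (1 - a)) / t ^+ 2))%:E)%E.
Proof.
move=> t0 a1; have tn0 : t != 0 by rewrite gt_eqF.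
pose f y := expR (- t) * ((1 - y) * exp_q k (t * (1 - y))).
pose F y := - (expR (- t) / t ^+ 2) * weighted_q_prim k.+1 (t * (1 - y)).
have fE y : expR (- (t * y)) * ((1 - y) * q_ext k (t * (1 - y))) = f y.
  rewrite /f /q_ext (_ : - t = - (t * y) + - (t * (1 - y))); last by ring.
  by rewrite expRD; ring.
have dF y : is_derive y 1 F (f y).
  apply: (is_derive_eq (is_derive_mul (is_derive_const (- (expR (- t) / t ^+ 2)) y)
    (is_derive_comp_mul (is_derive_weighted_q_primS k _) (is_derive_scale_sub t y)))).
  by rewrite /f; field.
have cf : continuous f.
  move=> y; apply: cvgM; first exact: cvg_cst.
  apply: cvgM; first by apply: cvgB; [exact: cvg_cst|exact: cvg_id].
  exact: (continuous_affine_comp _ _ _ (continuous_exp_q k)).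
under eq_integral do rewrite fE.
rewrite (FTC_if_itv b0 true a1 cf dF) /F subrr mulr0 weighted_q_prim_at0; congr EFin.
by rewrite mulr0 add0r; ring.
Qed.

(* The density at t of S_{k+1} on the event B_{k+1} <= s. *)
Definition time_density k s t : R :=
  if 0 < t < s then expR (- t) * (weighted_q_prim k.+1 t / t ^+ 2)
  else if s <= t then expR (- t) * (weighted_q_prim k.+1 s / t ^+ 2) else 0.

(** For t <= s the constraint holds for all y in (0, 1), so the lower limit is 0. For t > s it reads
    y >= 1 - s/t, a positive lower limit at which t(1-y) = s. *)
Lemma integral_density_SW_inner k s t : 0 < s ->
  (\int[mu]_y ((fun p => (density_SW k p)%:E) \_ [set p | p.1 * (1 - p.2) <=
      s]%R) (t, y) =
   (time_density k s t)%:E)%E.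
Proof.
move=> s0; have [t0|t0] := ltP 0 t; last first.
  rewrite /time_density [0 < t]ltNge t0 leNgt (le_lt_trans t0 s0)/=
      integral0_eq// => y _.
  by rewrite patchE /density_SW /= ltNge t0; case: ifP.
have memC y : ((t, y) \in [set p | p.1 * (1 - p.2) <= s]) = (t * (1 - y) <= s).
  by apply/idP/idP; rewrite inE.
have [ts|st] := leP t s.
  have -> : time_density k s t = expR (- t) * (weighted_q_prim k.+1 (t * (1 -
      0)) / t ^+ 2).
    (* At t = s the second branch of [time_density] applies, with the same value. *)
    rewrite /time_density t0 subr0 mulr1; move: ts; rewrite le_eqVlt.
    by case: ltgtP => //= ->.
  rewrite -(integral_density_SW_itv k t 0 false)//.
  apply: eq_integral => y _; rewrite patchE memC in_itv /density_SW /= t0/=.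
  case: ifPn => h //; case: ifPn => // /andP[y0 y1].
  by case/negP: h; rewrite (le_trans _ ts)// ler_piMr ?ltW//; lra.
have a1 : 1 - s / t <= 1 by rewrite gerBl divr_ge0 ?ltW.
have a0 : 0 < 1 - s / t by rewrite subr_gt0 ltr_pdivrMr// mul1r.
have -> : time_density k s t = expR (- t) * (weighted_q_prim k.+1 (t * (1 - (1 -
    s / t))) / t ^+ 2).
  rewrite /time_density t0 [t < s]ltNge (ltW st)/=;
      congr (_ * (weighted_q_prim _ _ / _)).
  by field; rewrite gt_eqF.
rewrite -(integral_density_SW_itv k t _ true)//.
apply: eq_integral => y _; rewrite patchE memC in_itv /density_SW /= t0/=.
have -> : (t * (1 - y) <= s) = (1 - s / t <= y).
  have -> : (t * (1 - y) <= s) = (1 - y <= s / t) by rewrite ler_pdivlMr// mulrC.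
  by apply/idP/idP => h; lra.
have [ay|ya] /= := leP (1 - s / t) y; last by [].
by rewrite (lt_le_trans a0 ay).
Qed.

(** [I2] is the real part of an extended integral; finiteness follows from the bound by s^{-2} times
    the exponential density. *)
Lemma I2E s : 0 < s ->
  (\int[mu]_(x in `[s, +oo[) (expR (- x) / x ^+ 2)%:E = (I2 s)%:E)%E.
Proof.
move=> s0; rewrite /I2 /Rintegral fineK// ge0_fin_numE; last first.
  by apply: integral_ge0 => x _; rewrite lee_fin divr_ge0 ?expR_ge0 ?sqr_ge0.
have mx : measurable_fun [set: R] (fun x => expR (- x) / x ^+ 2).
  apply: measurable_funM.
    exact: continuous_measurable_fun continuous_expRN.
  by apply: (measurableT_comp measurable_invr); exact: measurable_funX.
have s2 : 0 <= (s ^+ 2)^-1 by rewrite invr_ge0 sqr_ge0.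
apply: (@le_lt_trans _ _ (\int[mu]_(x in `[s, +oo[) ((s ^+ 2)^-1 *
    exponential_density x)%:E)%E).
  apply: ge0_le_integral => //=.
  - by move=> x _; rewrite lee_fin divr_ge0 ?expR_ge0 ?sqr_ge0.
  - exact/measurable_funTS/measurable_EFinP.
  - apply/measurable_funTS/measurable_EFinP; apply: measurable_funM => //.
    exact: measurable_exponential_density.
  - move=> x; rewrite in_itv/= andbT => sx; rewrite lee_fin /exponential_density.
    have x0 : 0 < x by exact: lt_le_trans sx.
    rewrite x0 mulrC ler_wpM2r ?expR_ge0//.
    by rewrite lef_pV2 ?posrE ?exprn_gt0// ler_pXn2r// nnegrE ltW.
under eq_integral do rewrite EFinM.
rewrite ge0_integralZl//=.
- have E1 : (\int[mu]_x (exponential_density x)%:E = 1)%E.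
    by rewrite -exponential_prob_density//; exact: (integral_exponential_pdf ltr01).
  rewrite lte_mul_pinfty ?lee_fin//.
  apply: (@le_lt_trans _ _ (\int[mu]_x (exponential_density x)%:E)%E);
      last by rewrite E1 ltry.
  apply: ge0_subset_integral => //.
    by apply/measurable_EFinP; exact: measurable_exponential_density.
  by move=> x _; rewrite lee_fin exponential_density_ge0.
- by apply: measurable_funTS; apply/measurable_EFinP;
    exact: measurable_exponential_density.
- by move=> x _; rewrite lee_fin exponential_density_ge0.
Qed.

Lemma integral_time_density k s : 0 < s ->
  (\int[mu]_t (time_density k s t)%:E =
   (1 - \sum_(j < k.+1) q_ext j s + weighted_q_prim k.+1 s * I2 s)%:E)%E.
Proof.
move=> s0; pose f1 t := expR (- t) * (weighted_q_prim k.+1 t / t ^+ 2).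
pose f2 t := expR (- t) / t ^+ 2.
have mV : measurable_fun [set: R] (fun t => (t ^+ 2)^-1).
  by apply: (measurableT_comp measurable_invr); exact: measurable_funX.
have mexp : measurable_fun [set: R] (fun t : R => expR (- t)).
  exact: continuous_measurable_fun continuous_expRN.
have mf1 : measurable_fun [set: R] f1.
  apply: measurable_funM => //; apply: measurable_funM => //.
  apply: continuous_measurable_fun.
  exact: is_derive_continuous (is_derive_weighted_q_primS k).
have mf2 : measurable_fun [set: R] f2 by exact: measurable_funM.
have N0 : 0 <= weighted_q_prim k.+1 s by rewrite weighted_q_prim_ge0// ltW.
(* The density splits over the disjoint ranges 0 < t < s and t >= s. *)
transitivity (\int[mu]_t (((EFin \o f1) \_ `]0%R, s[) t +
    ((fun t => (weighted_q_prim k.+1 s * f2 t)%:E) \_ `[s, +oo[) t))%E.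
  apply: eq_integral => t _; rewrite !patchE !mem_setE !in_itv/= andbT /time_density.
  have [ts|st] := ltP t s; rewrite ?andbT ?andbF /=.
    by case: ifP => _; rewrite ?add0e ?adde0.
  by rewrite add0e /f2; congr EFin; ring.
have mr1 : measurable_fun [set: R] ((EFin \o f1) \_ `]0%R, s[).
  apply/(measurable_restrictT _ (measurable_itv _)); apply: measurable_funTS.
  exact/measurable_EFinP.
have mr2 : measurable_fun [set: R] ((fun t => (weighted_q_prim k.+1 s * f2
    t)%:E) \_ `[s, +oo[).
  apply/(measurable_restrictT _ (measurable_itv _)); apply: measurable_funTS.
  by apply/measurable_EFinP; exact: measurable_funM.
have r1 t : setT t -> (0 <= ((EFin \o f1) \_ `]0%R, s[) t)%E.
  move=> _; rewrite patchE mem_setE in_itv/=; case: ifP => // /andP[t0 _].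
  by rewrite lee_fin /f1 mulr_ge0 ?expR_ge0 ?divr_ge0 ?sqr_ge0//
      weighted_q_prim_ge0// ltW.
have r2 t : setT t -> (0 <= ((fun t => (weighted_q_prim k.+1 s * f2 t)%:E) \_
    `[s, +oo[) t)%E.
  move=> _; rewrite patchE; case: ifP => // _.
  by rewrite lee_fin mulr_ge0 ?divr_ge0 ?expR_ge0 ?sqr_ge0.
rewrite (ge0_integralD mu measurableT r1 mr1 r2 mr2).
rewrite -!integral_mkcond/= /f1 (integral_weighted_q_prim k _ (ltW s0))
    [RHS]EFinD; congr (_ + _)%E.
under eq_integral do rewrite EFinM.
rewrite ge0_integralZl//=.
- by rewrite /f2 I2E// EFinM.
- exact/measurable_funTS/measurable_EFinP.
- by move=> t _; rewrite lee_fin divr_ge0 ?expR_ge0 ?sqr_ge0.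
Qed.

End final_integral.

Theorem theorem4 (R : realType) (d : measure_display) (T : measurableType d)
    (P : probability T R) (V E : nat -> {RV P >-> R})
    (hV : forall j (A : set R), measurable A ->
       P (V j @^-1` A) = uniform_prob (@ltr01 R) A)
    (hE : forall j (A : set R), measurable A ->
       P (E j @^-1` A) = exponential_prob (1 : R) A)
    (hind : mutually_independent P
       (joint_family (fun j => (V j : T -> R)) (fun j => (E j : T -> R))))
    (k : nat) (s : R) :
  (1 <= k)%N -> 0 < s ->
  P [set w | s < Bk (fun j => (V j : T -> R)) (fun j => (E j : T -> R)) k w] =
  ((- I2 s * (\int[lebesgue_measure]_(xi in `[0, s]) (xi * expR xi * qj k.-1 xi)))
    + \sum_(j < k) qj j s)%:E.
Proof.
case: k => // k _ s0 /=.
have dV j : has_density P lebesgue_measure (V j) uniform_density.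
  have mV : measurable_fun [set: T] (V j : T -> R) by [].
  split; [exact: mV|exact: measurable_uniform_density|exact:
      uniform_density_ge0|move=> A mA].
  by rewrite -uniform_prob_density//; exact: hV.
have dE j : has_density P lebesgue_measure (E j) exponential_density.
  have mE : measurable_fun [set: T] (E j : T -> R) by [].
  split; [exact: mE|exact: measurable_exponential_density|exact:
      exponential_density_ge0|move=> A mA].
  by rewrite -exponential_prob_density//; exact: hE.
have [mSW _ _ SW] := record_density P _ _ dV dE hind k.
pose C : set (R * R) := [set p | p.1 * (1 - p.2) <= s].
have mC : measurable C.
  have m1 : measurable_fun setT (fun p : R * R => p.1 * (1 - p.2) <= s).
    apply: measurable_fun_ler => //; apply: measurable_funM => //.
    exact: measurable_funB.
  rewrite [C](_ : _ = setT `&` (fun p : R * R => p.1 * (1 - p.2) <= s) @^-1`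
      [set true]).
    exact: m1.
  by rewrite setTI.
have -> : \int[lebesgue_measure]_(xi in `[0, s]) (xi * expR xi * qj k xi) =
    weighted_q_prim k.+1 s.
  rewrite /Rintegral -[RHS]/(fine (weighted_q_prim k.+1 s)%:E)
      -(integral_mul_exp_q k s (ltW s0)).
  congr fine; apply: eq_integral => x.
  (* At xi = 0 the default value of [qj] is killed by the factor xi; elsewhere e^xi q_k(xi) is
     [exp_q k xi]. *)
  rewrite inE/= in_itv/= => /andP[]; rewrite le_eqVlt => /orP[/eqP <- _|x0 _].
    by rewrite !mul0r.
  by rewrite qjE// /q_ext mulrA -[x * _ * _]mulrA -expRD subrr expR0 mulr1.
under eq_bigr do rewrite qjE//.
pose Y w := (\sum_(i < k.+1) E i w / \prod_(m < i.+1) V m w, \prod_(m < k.+2) V m w).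
have PC : P (Y @^-1` C) = (1 - \sum_(j < k.+1) q_ext j s + weighted_q_prim k.+1
    s * I2 s)%:E.
  rewrite SW// integral_mkcond fubini_tonelli1//=; last 2 first.
  - apply/(measurable_restrictT _ mC); apply: measurable_funTS.
    by apply/measurable_EFinP; exact: measurable_density_SW.
  - by move=> p; rewrite patchE; case: ifP => // _; rewrite lee_fin density_SW_ge0.
  rewrite -integral_time_density//; apply: eq_integral => t _.
  exact: integral_density_SW_inner.
(* The density was integrated over B_{k+1} <= s, so the tail is one minus that probability. *)
rewrite (_ : [set w | _] = ~` (Y @^-1` C)); last first.
  by apply/seteqP; split => w; rewrite /Bk /C /Y /= ltNge => /negP.
rewrite probability_setC; last exact: measurable_preimage.
by rewrite PC -EFinB; congr EFin; ring.
Qed.
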